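(* For every cyclic formula $\phi$, $\mathsf{GL}^\circ\vdash\Box^\bullet\phi\leftrightarrow\Box\phi$.
   Context: Labels: $\bot,\top$ and propositional variables (arity 0), $\neg,\Box$ (arity 1), $\wedge,\vee,\to$ (arity 2). A graph is $\langle V,r,S,\lambda\rangle$ with $V$ finite, root $r$, labelling $\lambda$, $S:V\to V^{*}$ ordered successors (length = arity of label); every vertex reachable from $r$. A (cyclic) formula is a graph in which every cycle (closed path of pairwise distinct vertices along successors) contains a $\Box$-labelled vertex. Bisimulation: $aRa'$ implies equal labels and $i$-th successors related; $\simeq$ = bisimilarity relating roots. $\phi$ modalised in $p$: every root-to-$p$ path passes a $\Box$-labelled vertex; then $\digamma p.\phi$ identifies the root with all $p$-labelled vertices (keeping the root's label). $\Box^\bullet\phi:=\digamma p.\Box(\phi\wedge p)$ with $p$ not in $\phi$. $\mathsf{CHL}$: least set of cyclic formulas containing all substitution instances of propositional tautologies, all $\Box(\phi\to\psi)\to(\Box\phi\to\Box\psi)$, all $\phi\leftrightarrow\psi$ with $\phi\simeq\psi$, closed under modus ponens, necessitation and Löb's rule (from $\vdash\Box\phi\to\phi$ infer $\vdash\phi$). $\mathsf{GL}^\circ$ is $\mathsf{CHL}$ extended with all instances of $\Box\phi\to\Box\Box\phi$ and closed under the same rules. *)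

(* Defs.v *)
From HB Require Import structures.
From mathcomp Require Import all_boot.

Set Implicit Arguments.
Unset Strict Implicit.
Unset Printing Implicit Defensive.

Inductive label : Type :=
  | LBot | LTop | LVar of nat | LNeg | LBox | LAnd | LOr | LImp.

Definition arity (l : label) : nat :=
  match l with
  | LBot | LTop | LVar _ => 0
  | LNeg | LBox => 1
  | LAnd | LOr | LImp => 2
  end.

Definition nat_of_label (l : label) : nat :=
  match l with
  | LBot => 0 | LTop => 1 | LNeg => 2 | LBox => 3
  | LAnd => 4 | LOr => 5 | LImp => 6 | LVar p => p.+4.+3
  end.

Definition label_of_nat (n : nat) : label :=
  match n with
  | 0 => LBot | 1 => LTop | 2 => LNeg | 3 => LBox
  | 4 => LAnd | 5 => LOr | 6 => LImp | p.+4.+3 => LVar p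
  end.

Lemma nat_of_labelK : cancel nat_of_label label_of_nat.
Proof. by case. Qed.

HB.instance Definition _ := Equality.copy label (can_type nat_of_labelK).

Record graph : Type := Graph {
  vert : finType;
  root : vert;
  succ : vert -> seq vert;
  lab : vert -> label;
  size_succ : forall v, size (succ v) = arity (lab v);
  reach : forall v, connect (grel succ) root v
}.

Definition edge (g : graph) : rel (vert g) := grel (@succ g).

(* [cycle e [::]] holds, so the empty sequence has to be excluded. *)
Definition cycles_guarded (V : finType) (S : V -> seq V) (l : V -> label) :=
  forall c : seq V, c != [::] -> cycle (grel S) c -> uniq c ->
    has (fun v => l v == LBox) c.

Record cform : Type := CForm {
  graph_of :> graph;
  guarded : cycles_guarded (@succ graph_of) (@lab graph_of)
}.

Definition bisimulation (g h : graph) (R : vert g -> vert h -> Prop) : Prop :=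
  forall a b, R a b ->
    lab a = lab b /\
    forall i, i < arity (lab a) -> R (nth a (succ a) i) (nth b (succ b) i).

Definition bisimilar (g h : graph) : Prop :=
  exists R : vert g -> vert h -> Prop, bisimulation R /\ R (root g) (root h).

Section Embedding.

Variables (V W : finType) (S : V -> seq V) (T : W -> seq W) (f : V -> W).
Hypotheses (injf : injective f) (Tf : forall v, T (f v) = map f (S v)).

Lemma emb_edge x y : grel T (f x) (f y) = grel S x y.
Proof. by rewrite /= Tf mem_map. Qed.

Lemma emb_connect x y : connect (grel S) x y -> connect (grel T) (f x) (f y).
Proof.
case/connectP=> s ps ->; apply/connectP; exists (map f s).
  by rewrite path_map (eq_path emb_edge).
by rewrite last_map.
Qed.

Lemma emb_path x s : path (grel T) (f x) s -> exists s', s = map f s'.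
Proof.
elim: s x => [|y s IH] x /=; first by exists [::].
rewrite Tf => /andP[/mapP[z _ ->]] /IH[s' ->].
by exists (z :: s').
Qed.

Lemma emb_guarded (l : V -> label) (m : W -> label) :
    (forall v, m (f v) = l v) -> cycles_guarded S l ->
  forall x s, cycle (grel T) (f x :: s) -> uniq (f x :: s) ->
    has (fun w => m w == LBox) (f x :: s).
Proof.
move=> ml gS x s cs; have [s' es] : exists s', s = map f s'.
  by move: cs; rewrite /= rcons_path => /andP[/emb_path].
rewrite es -map_cons (map_inj_uniq injf) => us.
have /hasP[v vs /eqP lv] : has (fun v => l v == LBox) (x :: s').
  apply: gS => //; move: cs; rewrite es -map_cons cycle_map.
  by rewrite (eq_cycle emb_edge).
by apply/hasP; exists (f v); [apply: map_f | rewrite ml lv].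
Qed.

End Embedding.

Section Nullary.

Variables (l : label) (hl : arity l = 0).

Let nul_succ (_ : unit) : seq unit := [::].

Lemma nul_size v : size (nul_succ v) = arity l.
Proof. by rewrite hl. Qed.

Lemma nul_reach v : connect (grel nul_succ) tt v.
Proof. by case: v; apply: connect0. Qed.

Lemma nul_guarded : cycles_guarded nul_succ (fun=> l).
Proof. by case=> // x [|y s]. Qed.

Definition nullary : cform :=
  @CForm (Graph nul_size nul_reach) nul_guarded.

End Nullary.

(* New root [None], whose only successor is the root of [a]. *)
Section Unary.

Variables (l : label) (hl : arity l = 1) (a : cform).

Definition un_succ (v : option (vert a)) : seq (option (vert a)) :=
  if v is Some x then map Some (succ x) else [:: Some (root a)].

Definition un_lab (v : option (vert a)) : label :=
  if v is Some x then lab x else l.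

Lemma un_size v : size (un_succ v) = arity (un_lab v).
Proof. by case: v => [x|] /=; rewrite ?size_map ?size_succ ?hl. Qed.

Lemma un_reach v : connect (grel un_succ) None v.
Proof.
case: v => [x|]; last exact: connect0.
apply: (connect_trans (y := Some (root a))); first by rewrite connect1 /= ?mem_head.
by apply: (emb_connect (S := @succ a)) (reach x) => //; apply: Some_inj.
Qed.

Lemma un_guarded : cycles_guarded un_succ un_lab.
Proof.
case=> // -[x|] s _ cs us.
  by apply: (emb_guarded (@Some_inj _) (S := @succ a)) (@guarded a) _ _ cs us.
move: cs; rewrite /= rcons_path /= => /andP[_].
by case: (last _ _) => [y|] //= /mapP[].
Qed.

Definition unary : cform := @CForm (Graph un_size un_reach) un_guarded.

End Unary.

(* Disjoint union with a new root [None], whose successors are the two roots. *)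
Section Binary.

Variables (l : label) (hl : arity l = 2) (a b : cform).

Let V : finType := option (vert a + vert b).
Let inA (x : vert a) : V := Some (inl x).
Let inB (x : vert b) : V := Some (inr x).

Definition bin_succ (v : V) : seq V :=
  match v with
  | None => [:: inA (root a); inB (root b)]
  | Some (inl x) => map inA (succ x)
  | Some (inr x) => map inB (succ x)
  end.

Definition bin_lab (v : V) : label :=
  match v with
  | None => l
  | Some (inl x) => lab x
  | Some (inr x) => lab x
  end.

Let injA : injective inA. Proof. by move=> x y []. Qed.
Let injB : injective inB. Proof. by move=> x y []. Qed.

Lemma bin_size v : size (bin_succ v) = arity (bin_lab v).
Proof. by case: v => [[x|x]|] /=; rewrite ?size_map ?size_succ ?hl. Qed.

Lemma bin_reach v : connect (grel bin_succ) None v.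
Proof.
case: v => [[x|x]|]; last exact: connect0.
  apply: (connect_trans (y := inA (root a))); first by rewrite connect1 //= mem_head.
  exact: (emb_connect (f := inA) injA (S := @succ a)) (reach x).
apply: (connect_trans (y := inB (root b))).
  by rewrite connect1 //= in_cons mem_head orbT.
exact: (emb_connect (f := inB) injB (S := @succ b)) (reach x).
Qed.

Lemma bin_guarded : cycles_guarded bin_succ bin_lab.
Proof.
case=> // -[[x|x]|] s _ cs us.
- exact: (emb_guarded injA (S := @succ a)) (@guarded a) _ _ cs us.
- exact: (emb_guarded injB (S := @succ b)) (@guarded b) _ _ cs us.
move: cs; rewrite /= rcons_path /= => /andP[_].
by case: (last _ _) => [[y|y]|] //= /mapP[].
Qed.

Definition binary : cform := @CForm (Graph bin_size bin_reach) bin_guarded.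

End Binary.

Definition cBot : cform := nullary (l := LBot) erefl.
Definition cTop : cform := nullary (l := LTop) erefl.
Definition cVar (p : nat) : cform := nullary (l := LVar p) erefl.
Definition cNeg (a : cform) : cform := unary (l := LNeg) erefl a.
Definition cBox (a : cform) : cform := unary (l := LBox) erefl a.
Definition cAnd (a b : cform) : cform := binary (l := LAnd) erefl a b.
Definition cOr (a b : cform) : cform := binary (l := LOr) erefl a b.
Definition cImp (a b : cform) : cform := binary (l := LImp) erefl a b.
Definition cIff (a b : cform) : cform := cAnd (cImp a b) (cImp b a).

Definition occurs (p : nat) (a : cform) : bool :=
  [exists v : vert a, lab v == LVar p].

Definition modalised (p : nat) (a : cform) : Prop :=
  forall s : seq (vert a), path (@edge a) (root a) s ->
    lab (last (root a) s) = LVar p ->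
    has (fun v => lab v == LBox) (root a :: s).

Section Digamma.

Variables (p : nat) (a : cform) (hm : modalised p a).

(* The quotient is realised on the vertices not labelled [p], the root being
   one of them: an edge into a [p]-labelled vertex becomes an edge into the
   root ([insubd] returns its default value there). *)
Let V : finType := {v : vert a | lab v != LVar p}.

Lemma root_nvar : lab (root a) != LVar p.
Proof.
by apply/eqP => hr; have := hm (s := [::]) isT hr; rewrite /= hr.
Qed.

Definition fp_root : V := exist _ (root a) root_nvar.

Definition fp_succ (v : V) : seq V :=
  [seq insubd fp_root w | w <- succ (val v)].

Definition fp_lab (v : V) : label := lab (val v).

Lemma fp_size v : size (fp_succ v) = arity (fp_lab v).
Proof. by rewrite size_map size_succ. Qed.

Lemma edge_var (v w : vert a) : lab v = LVar p -> edge v w = false.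
Proof.
move=> hv; have := size_succ v; rewrite hv /= => /size0nil e.
by rewrite /edge /= e.
Qed.

Lemma fp_reach v : connect (grel fp_succ) fp_root v.
Proof.
have fp_connect x s : path (@edge a) x s ->
    connect (grel fp_succ) (insubd fp_root x) (insubd fp_root (last x s)).
  elim: s x => [|y s IH] x /=; first by rewrite connect0.
  case/andP=> xy /IH; apply: connect_trans; apply: connect1.
  rewrite /= /fp_succ; apply: map_f; rewrite insubdK //.
  by apply/negP => /eqP hx; rewrite (edge_var y hx) in xy.
have /connectP[s ps vs] := reach (val v).
by have := fp_connect _ _ ps; rewrite -vs valKd -[root a]/(val fp_root) valKd.
Qed.

Lemma fp_edge x y : grel fp_succ x y ->
  edge (val x) (val y) \/
  y = fp_root /\ exists2 w, edge (val x) w & lab w = LVar p.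
Proof.
case/mapP=> w xw ->; case: (boolP (lab w == LVar p)) => hw.
  right; split; last by exists w => //; apply/eqP.
  by rewrite /insubd insubN //= hw.
by left; rewrite insubdK.
Qed.

Lemma fp_path x s : path (grel fp_succ) x s -> fp_root \notin s ->
  path (@edge a) (val x) (map val s).
Proof.
elim: s x => //= y s IH x /andP[/fp_edge xy ps]; rewrite in_cons negb_or.
case/andP=> ny ns; rewrite IH // andbT.
by case: xy => // -[ey]; rewrite ey eqxx in ny.
Qed.

Lemma fp_guarded : cycles_guarded fp_succ fp_lab.
Proof.
move=> c nc cc uc.
suff: has (fun v => lab v == LBox) (map val c) by rewrite has_map.
have old : cycle (@edge a) (map val c) ->
    has (fun v => lab v == LBox) (map val c).
  move=> ec; apply: (@guarded a) => //; first by case: (c) nc.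
  by rewrite map_inj_uniq //; apply: val_inj.
case: (boolP (fp_root \in c)) => [|nr]; last first.
  apply: old; case: c cc nr {nc uc} => //= x s; rewrite !rcons_path.
  case/andP=> ps /fp_edge lx nr; rewrite fp_path //=; last first.
    by move: nr; rewrite in_cons negb_or => /andP[].
  rewrite last_map; case: lx => // -[ex].
  by rewrite ex mem_head in nr.
case/rot_to => i s ec.
have hc : has (fun v => lab v == LBox) (map val c)
        = has (fun v => lab v == LBox) (map val (fp_root :: s)).
  by rewrite -ec !has_map has_rot.
move: uc; rewrite -(rot_uniq i) ec => /= /andP[nr us].
move: cc; rewrite -(rot_cycle i) ec /= rcons_path => /andP[ps lx].
have vs := fp_path ps nr.
case: (fp_edge lx) => [lr|[_ [w lw hw]]].
  apply: old; rewrite -(rot_cycle i) -map_rot ec /= rcons_path vs.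
  by rewrite (last_map val s fp_root).
rewrite hc; have := hm (s := rcons (map val s) w).
rewrite rcons_path vs (last_map val s fp_root) lw last_rcons => /(_ isT hw).
by rewrite /= has_rcons hw.
Qed.

Definition digamma : cform := @CForm (Graph fp_size fp_reach) fp_guarded.

End Digamma.

Lemma modalised_cBox (p : nat) (a : cform) : modalised p (cBox a).
Proof. by []. Qed.

(* This is the intended modality only if [p] does not occur in [a]. *)
Definition cBoxDot (p : nat) (a : cform) : cform :=
  digamma (@modalised_cBox p (cAnd a (cVar p))).

Inductive pform : Type :=
  | PBot | PTop | PVar of nat | PNeg of pform
  | PAnd of pform & pform | POr of pform & pform | PImp of pform & pform.

Fixpoint peval (e : nat -> bool) (t : pform) : bool :=
  match t with
  | PBot => false
  | PTop => true
  | PVar p => e p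
  | PNeg t => ~~ peval e t
  | PAnd t u => peval e t && peval e u
  | POr t u => peval e t || peval e u
  | PImp t u => peval e t ==> peval e u
  end.

Definition tautology (t : pform) : Prop := forall e, peval e t.

(* Each occurrence of a variable receives its own copy of the substituted graph;
   the instance with shared copies is bisimilar to this one. *)
Fixpoint psubst (s : nat -> cform) (t : pform) : cform :=
  match t with
  | PBot => cBot
  | PTop => cTop
  | PVar p => s p
  | PNeg t => cNeg (psubst s t)
  | PAnd t u => cAnd (psubst s t) (psubst s u)
  | POr t u => cOr (psubst s t) (psubst s u)
  | PImp t u => cImp (psubst s t) (psubst s u)
  end.

Inductive CHL_ext (Ax : cform -> Prop) : cform -> Prop :=
  | CHL_ax a : Ax a -> CHL_ext Ax a
  | CHL_taut t s : tautology t -> CHL_ext Ax (psubst s t)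
  | CHL_K a b :
      CHL_ext Ax (cImp (cBox (cImp a b)) (cImp (cBox a) (cBox b)))
  | CHL_bisim (a b : cform) : bisimilar a b -> CHL_ext Ax (cIff a b)
  | CHL_mp a b : CHL_ext Ax (cImp a b) -> CHL_ext Ax a -> CHL_ext Ax b
  | CHL_nec a : CHL_ext Ax a -> CHL_ext Ax (cBox a)
  | CHL_loeb a : CHL_ext Ax (cImp (cBox a) a) -> CHL_ext Ax a.

Definition CHL : cform -> Prop := CHL_ext (fun=> False).

Definition axiom4 (b : cform) : Prop :=
  exists a : cform, b = cImp (cBox a) (cBox (cBox a)).

Definition GLcirc : cform -> Prop := CHL_ext axiom4.

(* Main.v *)
Require Import Defs.
From mathcomp Require Import all_boot.

Set Implicit Arguments.
Unset Strict Implicit.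
Unset Printing Implicit Defensive.

(** Unfolding the cycle once, [d := cBoxDot p phi] is bisimilar to
    [cBox (cAnd phi d)], so [d] is a provable fixed point of
    [x |-> Box (phi /\ x)].  Hence [d -> Box phi].  Conversely, from
    [Box (Box phi -> d)] and [Box phi], axiom 4 gives [Box Box phi], so [Box d],
    so [Box (phi /\ d)], i.e. [d]; Löb's rule yields [Box phi -> d]. *)

(** The relation [x = f y] is a bisimulation, since [map] keeps the positions of successors. *)
Lemma bisimilar_fun (g h : graph) (f : vert h -> vert g) :
    (forall y, lab (f y) = lab y) -> (forall y, succ (f y) = map f (succ y)) ->
  f (Defs.root h) = Defs.root g -> bisimilar g h.
Proof.
move=> fl fs fr; exists (fun x y => x = f y); split=> // _ y ->; split=> // i.
by rewrite fl -size_succ fs => lti; rewrite (nth_map y).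
Qed.

Section Unfolding.

Variables (phi : cform) (p : nat).
Hypothesis hp : ~~ occurs p phi.

Let d : cform := cBoxDot p phi.

(** The folding map, with values in the graph before identification: the vertices of [d] are those
    of that graph not labelled [p]. *)
Definition fold_vert (y : vert (cBox (cAnd phi d))) :
    vert (cBox (cAnd phi (cVar p))) :=
  match y with
  | None => None
  | Some None => Some None
  | Some (Some (inl v)) => Some (Some (inl v))
  | Some (Some (inr x)) => val x
  end.

Lemma fold_vert_nvar y : lab (fold_vert y) != LVar p.
Proof.
case: y => [[[v|x]|]|] //=; last exact: (valP x).
by apply: contra hp => lv; apply/existsP; exists v.
Qed.

Lemma cBoxDot_unfold : bisimilar d (cBox (cAnd phi d)).
Proof.
(* By [fold_vert_nvar] the default of this [insubd] is never taken. *)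
pose f y : vert d := insubd (Defs.root d) (fold_vert y).
have fK y : val (f y) = fold_vert y by rewrite insubdK //; apply: fold_vert_nvar.
apply: (bisimilar_fun (f := f)); last by apply: val_inj; rewrite fK.
  by move=> y; rewrite -[LHS]/(lab (val (f y))) fK; case: y => [[[v|x]|]|].
move=> y; rewrite -[LHS]/(map (insubd (Defs.root d)) (succ (val (f y)))) fK.
case: y => [[[v|x]|]|] //=.
- by rewrite -!map_comp; apply: eq_map.
- have fE z : f (Some (Some (inr z))) = z by rewrite /f /= valKd.
  by rewrite -2!map_comp; apply/esym/(etrans (eq_map fE _))/map_id.
(* Right conjunct: the successor labelled [p] lies outside [d], so [insubd] redirects it to the
   root, onto which the root of the copy of [d] also folds. *)
congr [:: _; _]; apply: val_inj.
by rewrite fK /insubd insubN //= eqxx.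
Qed.

End Unfolding.

Section Derivations.

Variable Ax : cform -> Prop.

Lemma CHL_ext_trans (a b c : cform) :
  CHL_ext Ax (cImp a b) -> CHL_ext Ax (cImp b c) -> CHL_ext Ax (cImp a c).
Proof.
move=> hab hbc; apply: CHL_mp hbc; apply: CHL_mp hab.
pose t := PImp (PImp (PVar 0) (PVar 1))
  (PImp (PImp (PVar 1) (PVar 2)) (PImp (PVar 0) (PVar 2))).
(* [nth] serves as the substitution sending variables 0, 1, 2 to [a], [b], [c]. *)
apply: (@CHL_taut Ax t (nth a [:: a; b; c])) => e /=.
by case: (e 0) (e 1) (e 2) => [] [] [].
Qed.

Lemma CHL_ext_curry (a b c : cform) :
  CHL_ext Ax (cImp (cAnd a b) c) -> CHL_ext Ax (cImp a (cImp b c)).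
Proof.
apply: CHL_mp.
pose t := PImp (PImp (PAnd (PVar 0) (PVar 1)) (PVar 2))
  (PImp (PVar 0) (PImp (PVar 1) (PVar 2))).
apply: (@CHL_taut Ax t (nth a [:: a; b; c])) => e /=.
by case: (e 0) (e 1) (e 2) => [] [] [].
Qed.

Lemma CHL_ext_andl (a b : cform) : CHL_ext Ax (cImp (cAnd a b) a).
Proof.
apply: (@CHL_taut Ax (PImp (PAnd (PVar 0) (PVar 1)) (PVar 0))
  (nth a [:: a; b])) => e /=.
by case: (e 0) (e 1) => [] [].
Qed.

Lemma CHL_ext_andr (a b : cform) : CHL_ext Ax (cImp (cAnd a b) b).
Proof.
apply: (@CHL_taut Ax (PImp (PAnd (PVar 0) (PVar 1)) (PVar 1))
  (nth a [:: a; b])) => e /=.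
by case: (e 0) (e 1) => [] [].
Qed.

Lemma CHL_ext_conj (a b : cform) :
  CHL_ext Ax (cImp a (cImp b (cAnd a b))).
Proof.
apply: (@CHL_taut Ax (PImp (PVar 0) (PImp (PVar 1) (PAnd (PVar 0) (PVar 1))))
  (nth a [:: a; b])) => e /=.
by case: (e 0) (e 1) => [] [].
Qed.

(** Lets derivations run under a hypothesis [c] carried along as an antecedent, in place of a
    deduction theorem. *)
Lemma CHL_ext_app (c a b : cform) :
  CHL_ext Ax (cImp c (cImp a b)) -> CHL_ext Ax (cImp c a) ->
  CHL_ext Ax (cImp c b).
Proof.
move=> hcab hca; apply: CHL_mp hca; apply: CHL_mp hcab.
pose t := PImp (PImp (PVar 2) (PImp (PVar 0) (PVar 1)))
  (PImp (PImp (PVar 2) (PVar 0)) (PImp (PVar 2) (PVar 1))).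
apply: (@CHL_taut Ax t (nth a [:: a; b; c])) => e /=.
by case: (e 0) (e 1) (e 2) => [] [] [].
Qed.

Lemma CHL_ext_box_mono (a b : cform) :
  CHL_ext Ax (cImp a b) -> CHL_ext Ax (cImp (cBox a) (cBox b)).
Proof. by move/CHL_nec; apply: CHL_mp; apply: CHL_K. Qed.

Lemma CHL_ext_box_app (c a b : cform) :
  CHL_ext Ax (cImp c (cBox (cImp a b))) -> CHL_ext Ax (cImp c (cBox a)) ->
  CHL_ext Ax (cImp c (cBox b)).
Proof.
move=> hab; apply: CHL_ext_app.
by apply: CHL_ext_trans hab _; apply: CHL_K.
Qed.

End Derivations.

Lemma GLcirc_fixpoint_box (a d : cform) :
  GLcirc (cIff d (cBox (cAnd a d))) -> GLcirc (cIff d (cBox a)).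
Proof.
move=> hd.
have d_box : GLcirc (cImp d (cBox (cAnd a d))).
  by apply: CHL_mp hd; apply: CHL_ext_andl.
have box_d : GLcirc (cImp (cBox (cAnd a d)) d).
  by apply: CHL_mp hd; apply: CHL_ext_andr.
have d_boxa : GLcirc (cImp d (cBox a)).
  by apply: CHL_ext_trans d_box _; apply/CHL_ext_box_mono/CHL_ext_andl.
have boxa_d : GLcirc (cImp (cBox a) d).
  (* The context becomes [cAnd (cBox (cImp (cBox a) d)) (cBox a)]; it remains to derive
     [cBox (cAnd a d)] from it. *)
  apply: CHL_loeb; apply: CHL_ext_curry; apply: CHL_ext_trans box_d.
  apply: (@CHL_ext_box_app _ _ d).
    apply: CHL_ext_trans (CHL_ext_andr _ _ _) _.
    exact/CHL_ext_box_mono/CHL_ext_conj.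
  (* [cBox d] comes from the Löb hypothesis once axiom 4 turns [cBox a] into [cBox (cBox a)]. *)
  apply: CHL_ext_box_app (CHL_ext_andl _ _ _) _.
  by apply: CHL_ext_trans (CHL_ext_andr _ _ _) _; apply: CHL_ax; exists a.
by apply: CHL_mp boxa_d; apply: CHL_mp d_boxa; apply: CHL_ext_conj.
Qed.

Theorem theorem4p4 (phi : cform) (p : nat) (hp : ~~ occurs p phi) :
  GLcirc (cIff (cBoxDot p phi) (cBox phi)).
Proof. exact/GLcirc_fixpoint_box/CHL_bisim/cBoxDot_unfold. Qed.
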